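(* Let $p\in\{13,29\}$. Then for every Dehn $p$-colorable knot $K$, \[ \mathrm{mincol}_p(K)\ \ge\ \lfloor \log_2 p\rfloor+3 . \] (That is, $\mathrm{mincol}_{13}(K)\ge 6$ and $\mathrm{mincol}_{29}(K)\ge 7$ for all Dehn $13$-, resp. $29$-colorable knots $K$.)
   Context: Let $p$ be an odd prime and $\mathbb Z_p=\mathbb Z/p\mathbb Z$. Let $D$ be a diagram of a knot and $\mathcal R(D)$ its set of regions. At a crossing, label the four surrounding regions $x_1,x_2,x_3,x_4$ so that $x_2$ is adjacent to $x_1$ across an under-arc, $x_3$ is adjacent to $x_1$ across the over-arc, and $x_4$ is the region opposite to $x_1$. A Dehn $p$-coloring of $D$ is a map $C:\mathcal R(D)\to\mathbb Z_p$ such that at every crossing $C(x_1)+C(x_3)=C(x_2)+C(x_4)$ (this condition does not depend on which of the four regions is chosen as $x_1$). A crossing is trivially colored by $C$ if $C(x_1)=C(x_4)$ and $C(x_2)=C(x_3)$; $C$ is trivial if every crossing is trivially colored (equivalently, $C$ is constant or a checkerboard coloring), and nontrivial otherwise. A knot $K$ is Dehn $p$-colorable if some diagram of $K$ admits a nontrivial Dehn $p$-coloring. For such $K$, $\mathrm{mincol}_p(K)$ denotes the minimum, over all diagrams $D$ of $K$ and all nontrivial Dehn $p$-colorings $C$ of $D$, of the number $\#C(\mathcal R(D))$ of distinct colors used. *)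

(* Defs.v *)
From HB Require Import structures.
From mathcomp Require Import all_boot all_algebra.
Set Implicit Arguments. Unset Strict Implicit. Unset Printing Implicit Defensive.
Import GRing.Theory.

(* A diagram with n crossings.  Its darts (half-edges) are pairs (v, i):
   crossing v : 'I_n, position i : 'I_4 in counterclockwise order around v.
   Darts (v,0),(v,2) form the over-arc at v, darts (v,1),(v,3) the under-arc
   (any diagram can be labelled so; this is a labelling convention). *)
Notation dart n := ('I_n * 'I_4)%type.

Definition rot n (d : dart n) : dart n := (d.1, ordS d.2).

(* alpha : the edge involution pairing the two ends of each edge.
   face_perm = sigma o alpha; its orbits are the faces (= regions).
   The corner between darts e and rot e lies in the face of rot e. *)
Definition face_perm n (alpha : dart n -> dart n) (d : dart n) : dart n :=
  rot (alpha d).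

(* strand_perm = sigma^2 o alpha: go along an edge and straight through the
   next crossing; its orbits are the directed traversals of the components,
   so a one-component diagram (knot) has exactly 2 orbits. *)
Definition strand_perm n (alpha : dart n -> dart n) (d : dart n) : dart n :=
  rot (rot (alpha d)).

(* A knot diagram: a connected 4-valent map of genus 0 (Euler: V - E + F = 2,
   i.e. #faces = n + 2 since E = 2n) with a single component. *)
Definition is_knot_diagram n (alpha : dart n -> dart n) : Prop :=
  [/\ (0 < n)%N, involutive alpha, (forall d, alpha d != d),
      fcard (strand_perm alpha) predT = 2%N &
      fcard (face_perm alpha) predT = (n + 2)%N].

(* dart representing the region at corner k (k = 0..3) of crossing v,
   corner k being between darts (v,k) and (v,k+1). *)
Definition cdart n (v : 'I_n) (k : nat) : dart n := (v, ordS (inord k)).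

(* A Dehn p-coloring: a map on regions, represented as a map on darts that is
   constant on faces.  At crossing v: x1 = corner 0, x2 = corner 1 (across the
   under-arc dart 1), x3 = corner 3 (across the over-arc dart 0), x4 = corner 2. *)
Definition dehn_coloring (p n : nat) (alpha : dart n -> dart n)
    (C : dart n -> 'Z_p) : Prop :=
  (forall d, C (face_perm alpha d) = C d) /\
  (forall v : 'I_n,
     (C (cdart v 0) + C (cdart v 3) = C (cdart v 1) + C (cdart v 2))%R).

Definition trivially_colored (p n : nat) (C : dart n -> 'Z_p) (v : 'I_n) : Prop :=
  C (cdart v 0) = C (cdart v 2) /\ C (cdart v 1) = C (cdart v 3).

Definition nontrivial_coloring (p n : nat) (C : dart n -> 'Z_p) : Prop :=
  exists v : 'I_n, ~ trivially_colored C v.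

(* number of distinct colors used, #C(R(D)) (every region contains a dart) *)
Definition num_colors (p n : nat) (C : dart n -> 'Z_p) : nat :=
  #|[set C d | d : dart n]|.

(* Main.v *)
From mathcomp Require Import all_boot all_algebra ring.
Require Import Defs.
Set Implicit Arguments. Unset Strict Implicit. Unset Printing Implicit Defensive.
Import GRing.Theory.

(** Label each edge of the diagram by the unordered pair of colors on its two
    sides, with one common label for all the edges that have the same color on
    both sides. The knot is a single strand running straight through every
    crossing, so a function of the labels that is constant along both strands at
    every crossing takes the same value on all the edges. A crossing whose
    relation [l + r = l' + r'] is an identity imposes no condition on such a
    function, and a coloring with only crossings of this kind is trivial. After
    an affine change of colors the palette contains 0 and 1. Now consider all
    the other crossings that such a palette with at most 5 (p = 13) or 6
    (p = 29) colors allows: if the two strands of one of them lie in different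
    components of the graph that these crossings define on the labels, then it
    does not occur in the diagram. For every palette, discarding such crossings
    repeatedly leaves none. *)

Lemma fconnect_either (T : finType) (f : T -> T) (x y z : T) :
  injective f -> fcard f predT = 2 -> ~~ fconnect f x y ->
  fconnect f x z || fconnect f y z.
Proof.
move=> f_inj card2 nxy; apply: contraT => /norP[nxz nyz].
have symf := fconnect_sym f_inj.
pose roots := [:: froot f x; froot f y; froot f z].
have uniq_roots : uniq roots.
  by rewrite /= !inE !(root_connect symf) (negPf nxy) (negPf nxz) (negPf nyz).
suff: size roots <= fcard f predT by rewrite card2.
rewrite -(card_uniqP uniq_roots) /n_comp_mem.
apply/subset_leq_card/subsetP => r.
by rewrite !inE => /or3P[] /eqP ->; rewrite (roots_root symf).
Qed.

Section AllSubseq.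

Variable T : eqType.

Fixpoint all_subseq (P : pred (seq T)) (m : nat) (s : seq T) : bool :=
  match m, s with
  | m'.+1, x :: s' =>
    all_subseq (fun t => P (x :: t)) m' s' && all_subseq P m s'
  | _, _ => P [::]
  end.

Lemma all_subseqP (P : pred (seq T)) (m : nat) (s : seq T) :
  reflect (forall t, subseq t s -> size t <= m -> P t) (all_subseq P m s).
Proof.
elim: s m P => [|x s IH] [|m] P /=.
1-3: by apply: (iffP idP) => [P_nil [] // | ]; apply.
apply: (iffP andP) => [[/IH Px /IH Ps] [|y t] //= | Pxs].
- by move=> _ _; apply: Ps; rewrite ?sub0seq.
- by case: eqP => [-> | _]; [apply: Px | apply: Ps].
split; apply/IH => t ts; first by move=> tm; apply: Pxs; rewrite /= ?eqxx.
by apply/Pxs; apply: subseq_trans ts (subseq_cons s x).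
Qed.

End AllSubseq.

Section StrandConnectivity.

Variables (n : nat) (alpha : dart n -> dart n).
Hypothesis knot_alpha : is_knot_diagram alpha.

Let alphaK : involutive alpha. Proof. by case: knot_alpha. Qed.

Lemma dart_rot_inj : injective (@rot n).
Proof. by move=> [v i] [w j] [-> ij]; congr pair; apply/ordS_inj/val_inj. Qed.

Lemma iter4_dart_rot (d : dart n) : rot (rot (rot (rot d))) = d.
Proof. by case: d => v [[|[|[|[]]]] //= i]; congr pair; apply: val_inj. Qed.

Lemma dart_rot2_neq (d : dart n) : rot (rot d) <> d.
Proof. by case: d => v [[|[|[|[]]]] //= i] []. Qed.

Lemma strand_perm_inj : injective (strand_perm alpha).
Proof. by move=> d e /dart_rot_inj /dart_rot_inj /(inv_inj alphaK). Qed.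

(* [alpha] conjugates the strand permutation to its inverse, so halving [k]
   would produce a fixed point of [alpha] or of [rot \o rot]. *)
Lemma iter_strand_perm_neq_alpha (k : nat) (d : dart n) :
  iter k (strand_perm alpha) d <> alpha d.
Proof.
have [_ _ alpha_neq _ _] := knot_alpha.
elim/ltn_ind: k d => -[|[|k]] IH d /=.
- by apply/eqP; rewrite eq_sym.
- exact: dart_rot2_neq.
move=> itd; apply: (IH k (leqnSn _) (strand_perm alpha d)).
apply: strand_perm_inj.
by rewrite -iterSr /= itd /strand_perm alphaK iter4_dart_rot.
Qed.

Lemma strand_invariant_const (T : Type) (g : dart n -> T) :
  (forall d, g (alpha d) = g d) -> (forall d, g (rot (rot d)) = g d) ->
  forall d e, g d = g e.
Proof.
move=> g_alpha g_rot2 d e; have [_ _ _ card2 _] := knot_alpha.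
have g_fconnect a b : fconnect (strand_perm alpha) a b -> g a = g b.
  move=> /iter_findex <-; elim: (findex _ _ _) => //= k ->.
  by rewrite /strand_perm g_rot2 g_alpha.
have not_dad : ~~ fconnect (strand_perm alpha) d (alpha d).
  by apply/negP => /iter_findex; exact: iter_strand_perm_neq_alpha.
have [/g_fconnect // | /g_fconnect <-] :=
  orP (fconnect_either e strand_perm_inj card2 not_dad).
by rewrite g_alpha.
Qed.

End StrandConnectivity.

(* The labels of the two edges of the over-strand at a crossing, and of the two
   edges of the under-strand. *)
Notation strand_pair L := ((L * L) * (L * L))%type.

(* The colors [((l, r), (l', r'))] around a crossing: one over-edge separates
   [l] from [r], the other separates [l'] from [r'], with [l'] next to [l]. *)
Notation color_quad := ((nat * nat) * (nat * nat))%type.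

Section Linkage.

Variable L : eqType.

Definition coherent (T : eqType) (h : L -> T) (x : strand_pair L) : bool :=
  (h x.1.1 == h x.1.2) && (h x.2.1 == h x.2.2).

Definition strands_agree (T : eqType) (h : L -> T) (x : strand_pair L) : bool :=
  h x.1.1 == h x.2.1.

Definition linked (X : seq (strand_pair L)) : Prop :=
  forall (T : eqType) (h : L -> T),
    all (coherent h) X -> all (strands_agree h) X.

Definition same_strand (e f : L * L) : bool := (f == e) || (f == (e.2, e.1)).

Definition same_strands (x y : strand_pair L) : bool :=
  same_strand x.1 y.1 && same_strand x.2 y.2.

Definition covers (Q X : seq (strand_pair L)) : bool :=
  all (fun y => has (same_strands y) Q) X.

Definition identify (e : L * L) (cls : L -> L) : L -> L :=
  let a := cls e.1 in let b := cls e.2 in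
  fun y => let c := cls y in if c == a then b else c.

(* A representative of the component of a label in the graph whose edges are
   the strands of the crossings in [Q]. *)
Definition strand_class (Q : seq (strand_pair L)) : L -> L :=
  foldr (fun x cls => identify x.1 (identify x.2 cls)) id Q.

Definition prune (Q : seq (strand_pair L)) : seq (strand_pair L) :=
  let cls := strand_class Q in [seq x <- Q | strands_agree cls x].

Definition unlinkable (Q : seq (strand_pair L)) : bool :=
  nilp (iter (size Q) prune Q).

Lemma same_strands_coherent (T : eqType) (h : L -> T) (x y : strand_pair L) :
  same_strands x y -> coherent h x = coherent h y.
Proof.
move: x y => [[a b] [c d]] [e f] /andP[/= ab cd]; rewrite /coherent /=.
by congr (_ && _); [case/orP: ab | case/orP: cd] => /eqP ->; rewrite // eq_sym.
Qed.

Lemma same_strands_agree (T : eqType) (h : L -> T) (x y : strand_pair L) :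
  same_strands x y -> coherent h x -> strands_agree h x = strands_agree h y.
Proof.
move: x y => [[a b] [c d]] [e f] /andP[/= ab cd] /andP[/= /eqP hab /eqP hcd].
by case/orP: ab => /eqP ->; case/orP: cd => /eqP ->;
  rewrite /strands_agree /= ?hab ?hcd.
Qed.

Lemma same_strands_refl : reflexive same_strands.
Proof. by move=> x; rewrite /same_strands /same_strand !eqxx. Qed.

Lemma identify_eq (e : L * L) (cls : L -> L) :
  identify e cls e.1 = identify e cls e.2.
Proof. by rewrite /identify eqxx; case: ifP. Qed.

Lemma eq_identify (e : L * L) (cls : L -> L) (a b : L) :
  cls a = cls b -> identify e cls a = identify e cls b.
Proof. by rewrite /identify => ->. Qed.

Lemma strand_class_coherent (Q : seq (strand_pair L)) :
  all (coherent (strand_class Q)) Q.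
Proof.
elim: Q => //= x Q IH; apply/andP; split.
  by apply/andP; split; apply/eqP; [|apply: eq_identify]; apply: identify_eq.
apply: sub_all IH => y /andP[/eqP over /eqP under].
by apply/andP; split; apply/eqP; do 2!apply: eq_identify.
Qed.

Lemma prune_covers (Q X : seq (strand_pair L)) :
  linked X -> covers Q X -> covers (prune Q) X.
Proof.
move=> linkX /allP covQX; set cls := strand_class Q.
have cohX : all (coherent cls) X.
  apply/allP => y /covQX /hasP[x xQ yx]; rewrite (same_strands_coherent _ yx).
  exact: (allP (strand_class_coherent Q)).
apply/allP => y yX; have /hasP[x xQ yx] := covQX y yX.
apply/hasP; exists x => //.
rewrite mem_filter xQ andbT -(same_strands_agree yx) ?(allP cohX) //.
exact: (allP (linkX _ _ cohX)).
Qed.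

Lemma unlinkable_nil (Q X : seq (strand_pair L)) :
  unlinkable Q -> linked X -> covers Q X -> X = [::].
Proof.
rewrite /unlinkable => /nilP pruneQ linkX covQX.
have {covQX}: covers (iter (size Q) prune Q) X.
  by elim: (size Q) => //= k; apply: prune_covers.
by rewrite pruneQ; case: X {linkX}.
Qed.

End Linkage.

(* With one label for all the edges having the same color on both sides, the
   under-edges of a crossing colored [((x, y), (x, y))] have the same label. *)
Definition edge_label (x y : nat) : option (nat * nat) :=
  if x == y then None else Some (minn x y, maxn x y).

Lemma edge_labelC (x y : nat) : edge_label x y = edge_label y x.
Proof. by rewrite /edge_label eq_sym minnC maxnC. Qed.

Lemma edge_labelxx (x : nat) : edge_label x x = None.
Proof. by rewrite /edge_label eqxx. Qed.

Definition strand_labels (q : color_quad) : strand_pair (option (nat * nat)) :=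
  let: ((l, r), (l', r')) := q in
  ((edge_label l r, edge_label l' r'), (edge_label l l', edge_label r r')).

Lemma same_strands_symm (l r l' r' : nat) :
  let x := strand_labels ((l, r), (l', r')) in
  [/\ same_strands x (strand_labels ((l', r'), (l, r))),
      same_strands x (strand_labels ((r, l), (r', l'))) &
      same_strands x (strand_labels ((r', l'), (r, l)))].
Proof.
rewrite /strand_labels (edge_labelC r l) (edge_labelC r' l').
rewrite (edge_labelC l' l) (edge_labelC r' r) /same_strands /same_strand /=.
by rewrite !eqxx ?orbT.
Qed.

(* For a solution of [l + r = l' + r'] this says that the relation is not an
   identity. *)
Definition essential (q : color_quad) : bool :=
  let: ((l, r), (l', r')) := q in [&& l != l', l != r', r != l' & r != r'].

(* Up to the symmetries of a crossing, [l] is the color coming first in [S]. *)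
Fixpoint palette_crossings (p : nat) (S : seq nat) : seq color_quad :=
  if S is l :: S' then
    [seq q <- [seq ((l, r), (l', (l + r + (p - l')) %% p)) | r <- S, l' <- S']
       | q.2.2 \in S'] ++ palette_crossings p S'
  else [::].

Definition unlinkable_palette (p : nat) (S : seq nat) : bool :=
  unlinkable [seq strand_labels q | q <- palette_crossings p S].

Definition unlinkable_palettes (p k : nat) : bool :=
  all_subseq (fun S => unlinkable_palette p [:: 0, 1 & S])
    (k - 2) (iota 2 (p - 2)).

Section ZpPalettes.

Variable p : nat.
Hypothesis p_gt1 : 1 < p.

Lemma ltn_Zp (x : 'Z_p) : x < p.
Proof. by have := ltn_ord x; rewrite [X in _ < X](Zp_cast p_gt1). Qed.

Lemma val_ZpDB (x y z : 'Z_p) : (x + y - z)%R = (x + y + (p - z)) %% p :> nat.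
Proof.
by rewrite /= modnDm [X in X - z](Zp_cast p_gt1) [X in _ %% X](Zp_cast p_gt1).
Qed.

Lemma Zp_set_palette (P : {set 'Z_p}) : {subset [:: 0; 1]%R <= P} ->
  exists S, [/\ subseq S (iota 2 (p - 2)), (size S).+2 <= #|P| &
    {in P, forall x, val x \in [:: 0, 1 & S]}].
Proof.
move=> P01; pose S := [seq i <- iota 2 (p - 2) | i \in [seq val x | x in P]].
exists S; split=> [||x xP]; first exact: filter_subseq.
  rewrite (cardsD1 0%R) P01 ?mem_head // (cardsD1 1%R (P :\ 0%R)) !inE /=.
  rewrite P01 ?inE ?eqxx ?orbT //= !add1n !ltnS -(size_image val).
  apply: uniq_leq_size => [|i]; first by rewrite filter_uniq ?iota_uniq.
  rewrite mem_filter mem_iota => /andP[/imageP[x xP ->] /andP[x_gt1 _]].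
  by apply: image_f; rewrite !inE xP andbT; case: x x_gt1 {xP} => -[|[]].
rewrite !inE mem_filter mem_iota subnKC // ltn_Zp (image_f _ xP) andbT /=.
by case: (nat_of_ord x) => [|[]].
Qed.

Lemma palette_crossings_head (S : seq nat) (l r l' r' : 'Z_p) :
  val r \in val l :: S -> val l' \in S -> val r' \in S -> (l + r = l' + r')%R ->
  ((val l, val r), (val l', val r')) \in palette_crossings p (val l :: S).
Proof.
move=> rS l'S r'S lr; rewrite mem_cat mem_filter r'S.
have -> : val r' = (l + r + (p - l')) %% p.
  by rewrite -val_ZpDB lr addrAC subrr add0r.
by rewrite (allpairs_f (fun x y => ((val l, x), (y, (l + x + (p - y)) %% p)))).
Qed.

Lemma palette_crossings_complete (S : seq nat) (l r l' r' : 'Z_p) :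
  (l + r = l' + r')%R -> all (mem S) [:: val l; val r; val l'; val r'] ->
  essential ((val l, val r), (val l', val r')) ->
  exists2 q, q \in palette_crossings p S &
    same_strands (strand_labels ((val l, val r), (val l', val r')))
      (strand_labels q).
Proof.
move=> lr colS ess; elim: S colS => [|s S IH] /and5P[// lS rS l'S r'S _].
have tail (x : 'Z_p) : val x \in s :: S -> val x != s -> val x \in S.
  by rewrite inE => /orP[/eqP -> | //]; rewrite eqxx.
have [rev mirror turn] := same_strands_symm (val l) (val r) (val l') (val r').
have /and4P[ll' lr' rl' rr'] := ess.
have [ls | l_neq] := eqVneq (val l) s.
  exists ((val l, val r), (val l', val r')); last exact: same_strands_refl.
  by rewrite -ls in rS l'S r'S tail *; apply: palette_crossings_head;
    rewrite ?tail // eq_sym.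
have [rs | r_neq] := eqVneq (val r) s.
  exists ((val r, val l), (val r', val l')); last exact: mirror.
  by rewrite -rs in lS l'S r'S tail *; apply: palette_crossings_head;
    rewrite ?tail ?[(_ + l)%R]addrC ?[(r' + _)%R]addrC // eq_sym.
have [l's | l'_neq] := eqVneq (val l') s.
  exists ((val l', val r'), (val l, val r)); last exact: rev.
  by rewrite -l's in lS rS r'S tail *; apply: palette_crossings_head;
    rewrite ?tail.
have [r's | r'_neq] := eqVneq (val r') s.
  exists ((val r', val l'), (val r, val l)); last exact: turn.
  by rewrite -r's in lS rS l'S tail *; apply: palette_crossings_head;
    rewrite ?tail // addrC -lr addrC.
have [|q qS same_q] := IH; first by rewrite /= !tail.
by exists q; rewrite // mem_cat qS orbT.
Qed.

End ZpPalettes.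

Lemma Zp_unit_neq0 (p : nat) (x : 'Z_p) :
  prime p -> x != 0%R -> x \is a GRing.unit.
Proof.
move=> p_pr x_neq0; have p_gt1 := prime_gt1 p_pr.
by rewrite -[x]natr_Zp unitZpE // prime_coprime // gtnNdvd ?ltn_Zp // lt0n.
Qed.

Section Coloring.

Variables (p n : nat) (alpha : dart n -> dart n) (C : dart n -> 'Z_p).
Hypotheses (knot_alpha : is_knot_diagram alpha) (dehnC : dehn_coloring alpha C).

(* The edge at the dart [(v, k)] separates [corner v k] from [corner v k.+1]. *)
Definition corner (v : 'I_n) (k : nat) : 'Z_p := C (v, inord k).

Definition crossing_colors (v : 'I_n) : color_quad :=
  ((val (corner v 0), val (corner v 1)), (val (corner v 3), val (corner v 2))).

Lemma dart_rot_inord (v : 'I_n) (k : nat) :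
  k < 4 -> rot (v, inord k) = (v, inord (k.+1 %% 4)).
Proof.
by move=> k4; congr pair; apply/val_inj; rewrite /= !inordK ?ltn_mod.
Qed.

Lemma color_cdart (v : 'I_n) (k : nat) :
  k < 4 -> C (cdart v k) = corner v (k.+1 %% 4).
Proof. by move=> k4; rewrite /corner -dart_rot_inord. Qed.

Lemma corner_eq (v : 'I_n) :
  (corner v 0 + corner v 1 = corner v 3 + corner v 2)%R.
Proof.
by rewrite addrC [RHS]addrC; have := dehnC.2 v; rewrite !color_cdart.
Qed.

Lemma trivially_coloredP (v : 'I_n) :
  trivially_colored C v <-> corner v 0 = corner v 2 /\ corner v 1 = corner v 3.
Proof. by rewrite /trivially_colored !color_cdart //; split=> -[]. Qed.

Lemma inessential_cases (v : 'I_n) : ~~ essential (crossing_colors v) ->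
  trivially_colored C v \/ corner v 0 = corner v 3 /\ corner v 1 = corner v 2.
Proof.
rewrite trivially_coloredP !negb_and !negbK; have := corner_eq v.
move=> relation /or4P[] /eqP /val_inj xy; move: relation; rewrite xy.
- by move=> /addrI; right.
- by rewrite addrC => /addIr; left.
- by rewrite addrC => /addrI; left.
- by move=> /addIr; right.
Qed.

Lemma inessential_coherent (T : eqType) (h : option (nat * nat) -> T)
    (v : 'I_n) :
  ~~ essential (crossing_colors v) ->
  coherent h (strand_labels (crossing_colors v)).
Proof.
move=> /inessential_cases; rewrite trivially_coloredP /coherent /=.
case=> -[-> ->]; first by rewrite edge_labelC !eqxx.
by rewrite !edge_labelxx !eqxx.
Qed.

Lemma crossings_linked :
  linked [seq strand_labels (crossing_colors v) | v : 'I_n].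
Proof.
move=> T h /allP cohX; apply/allP => _ /imageP[v _ ->].
have coh w : coherent h (strand_labels (crossing_colors w)).
  by apply: cohX; apply: image_f.
have [_ alphaK _ _ _] := knot_alpha.
pose g d := h (edge_label (val (C d)) (val (C (rot d)))).
have gE w k : k < 4 ->
    g (w, inord k) =
    h (edge_label (val (corner w k)) (val (corner w (k.+1 %% 4)))).
  by move=> k4; rewrite /g dart_rot_inord.
have g_alpha d : g (alpha d) = g d.
  have C_rot_alpha e : C (rot (alpha e)) = C e by exact: dehnC.1.
  by rewrite /g edge_labelC C_rot_alpha -(C_rot_alpha (alpha d)) alphaK.
have g_rot2 d : g (rot (rot d)) = g d.
  case: d => w i; have /andP[/= /eqP over /eqP under] := coh w.
  rewrite -[i]inord_val !dart_rot_inord ?ltn_mod // !gE ?ltn_mod //.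
  case: i => -[|[|[|[|//]]]] //= _.
  - by rewrite over edge_labelC.
  - by rewrite -under edge_labelC.
  - by rewrite over edge_labelC.
  - by rewrite -under edge_labelC.
have g_const := strand_invariant_const knot_alpha g_alpha g_rot2.
have := g_const (v, inord 0) (v, inord 3).
by rewrite /strands_agree !gE //= => ->; rewrite edge_labelC.
Qed.

Lemma essential_crossings_linked :
  linked [seq strand_labels (crossing_colors v)
            | v in [pred v | essential (crossing_colors v)]].
Proof.
move=> T h coh; apply/allP => _ /imageP[v v_ess ->].
apply: (allP (crossings_linked _)); last exact: image_f.
apply/allP => _ /imageP[w _ ->].
have [w_ess | /inessential_coherent //] :=
  boolP (essential (crossing_colors w)).
by apply: (allP coh); apply: image_f.
Qed.

Lemma nontrivial_essential : nontrivial_coloring C ->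
  exists v, essential (crossing_colors v).
Proof.
move=> [v nontriv_v]; apply/existsP; apply: contraT => /existsPn iness.
case: nontriv_v; case: (inessential_cases (iness v)) => // -[e03 e12].
have /allP agree : all (strands_agree isSome)
    [seq strand_labels (crossing_colors w) | w : 'I_n].
  apply: crossings_linked; apply/allP => _ /imageP[w _ ->].
  exact: inessential_coherent.
have := agree _ (image_f _ (erefl : v \in 'I_n)).
rewrite /strands_agree /= -e03 edge_labelxx /edge_label.
case: ifP => // /eqP /val_inj e01 _.
by apply/trivially_coloredP; rewrite -e03 -e12 e01.
Qed.

Lemma unlinkable_palette_trivial (S : seq nat) :
  1 < p -> unlinkable_palette p S -> (forall d, val (C d) \in S) ->
  ~ nontrivial_coloring C.
Proof.
move=> p_gt1 unlinkS colS /nontrivial_essential[v v_ess].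
have := unlinkable_nil unlinkS essential_crossings_linked.
set X := image _ _ => X_nil; suff: strand_labels (crossing_colors v) \in X.
  rewrite X_nil //; apply/allP => _ /imageP[w w_ess ->].
  have [||q qS same_q] :=
    palette_crossings_complete p_gt1 (corner_eq w) (S := S).
  - by rewrite /= !colS.
  - exact: w_ess.
  by apply/hasP; exists (strand_labels q); rewrite ?map_f.
exact: image_f.
Qed.

End Coloring.

Lemma dehn_coloring_affine (p n : nat) (alpha : dart n -> dart n)
    (C : dart n -> 'Z_p) (u a : 'Z_p) :
  dehn_coloring alpha C -> dehn_coloring alpha (fun d => u * (C d - a))%R.
Proof.
move=> [C_face C_crossing]; split=> [d | v]; first by rewrite C_face.
transitivity (u * ((C (cdart v 0) + C (cdart v 3)) - a - a))%R; first by ring.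
by rewrite C_crossing; ring.
Qed.

Lemma dehn_coloring_normalize (p n : nat) (alpha : dart n -> dart n)
    (C : dart n -> 'Z_p) :
  prime p -> dehn_coloring alpha C -> nontrivial_coloring C ->
  exists C' : dart n -> 'Z_p,
    [/\ dehn_coloring alpha C', nontrivial_coloring C',
        num_colors C' = num_colors C &
        {subset [:: 0; 1]%R <= [set C' d | d : dart n]}].
Proof.
move=> p_pr dehnC [v nontriv_v].
have [d0 [d1 neC]] : exists d0 d1, C d0 != C d1.
  have [eq02 | ne02] := eqVneq (C (cdart v 0)) (C (cdart v 2)); last first.
    by exists (cdart v 0), (cdart v 2).
  have [eq13 | ne13] := eqVneq (C (cdart v 1)) (C (cdart v 3)); last first.
    by exists (cdart v 1), (cdart v 3).
  by case: nontriv_v.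
have unit_C10 : (C d1 - C d0)%R \is a GRing.unit.
  by apply: Zp_unit_neq0; rewrite // subr_eq0 eq_sym.
pose f (x : 'Z_p) := ((C d1 - C d0)^-1 * (x - C d0))%R.
have f_inj : injective f.
  by move=> x y /(mulrI _) /addIr; apply; rewrite unitrV.
exists (f \o C); split.
- exact: dehn_coloring_affine.
- by exists v => -[/f_inj C02 /f_inj C13]; case: nontriv_v.
- by rewrite -[RHS](card_imset _ f_inj) -imset_comp.
move=> x; rewrite !inE => /orP[]/eqP->; apply/imsetP.
  by exists d0; rewrite //= /f subrr mulr0.
by exists d1; rewrite //= /f mulVr.
Qed.

Lemma unlinkable_palettes_num_colors (p k n : nat) (alpha : dart n -> dart n)
    (C : dart n -> 'Z_p) :
  prime p -> unlinkable_palettes p k -> is_knot_diagram alpha ->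
  dehn_coloring alpha C -> nontrivial_coloring C -> k < num_colors C.
Proof.
move=> p_pr /all_subseqP unlink knot_alpha dehnC nontrivC.
have p_gt1 := prime_gt1 p_pr.
have [C' [dehnC' nontrivC' <- C'01]] :=
  dehn_coloring_normalize p_pr dehnC nontrivC.
rewrite ltnNge; apply/negP => num_le.
have [S [subS sizeS memS]] := Zp_set_palette p_gt1 C'01.
have unlinkS : unlinkable_palette p [:: 0, 1 & S].
  apply: unlink; rewrite // -[size S](addKn 2) leq_sub2r //.
  exact: leq_trans sizeS num_le.
apply: (unlinkable_palette_trivial knot_alpha dehnC' p_gt1 unlinkS) nontrivC'.
by move=> d; apply: memS; apply: imset_f.
Qed.

Lemma unlinkable_palettes_13_5 : unlinkable_palettes 13 5.
Proof. by vm_compute. Qed.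

Lemma unlinkable_palettes_29_6 : unlinkable_palettes 29 6.
Proof. by vm_compute. Qed.

Theorem theorem5p1 (p : nat) :
  (p = 13 \/ p = 29)%N ->
  forall (n : nat) (alpha : 'I_n * 'I_4 -> 'I_n * 'I_4) (C : 'I_n * 'I_4 -> 'Z_p),
    is_knot_diagram alpha ->
    dehn_coloring alpha C ->
    nontrivial_coloring C ->
    (trunc_log 2 p + 3 <= num_colors C)%N.
Proof.
case=> -> n alpha C knot_alpha dehnC nontrivC.
  exact: (unlinkable_palettes_num_colors _ unlinkable_palettes_13_5 knot_alpha).
exact: (unlinkable_palettes_num_colors _ unlinkable_palettes_29_6 knot_alpha).
Qed.
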